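(* Let $p$ be a prime and let $a$ be a positive integer. Then $$\frac1{p^a}\sum_{k=0}^{p^a-1}(21k+8)\binom{2k}k^3\equiv 8+16p^{3}B_{p-3}\pmod{p^{4}},$$ where $B_{-1}$ (occurring when $p=2$) is regarded as zero.
   Context: $B_0,B_1,B_2,\ldots$ are the Bernoulli numbers, defined by $\frac{x}{e^x-1}=\sum_{n\ge0}B_nx^n/n!$. A congruence $a\equiv b\pmod{p^m}$ between rationals with denominators prime to $p$ means $(a-b)/p^m$ has denominator prime to $p$. *)

(* Defs.v *)
From mathcomp Require Import all_boot all_order all_algebra.

Set Implicit Arguments.
Unset Strict Implicit.
Unset Printing Implicit Defensive.

Import Order.TTheory GRing.Theory Num.Theory.
Local Open Scope ring_scope.

(* Formal power series over rat, given by their coefficient sequences. *)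
Definition fps_mul (f g : nat -> rat) (n : nat) : rat :=
  \sum_(i < n.+1) f i * g (n - i)%N.

(* The first n.+1 coefficients of 1 / f, for f 0 != 0. *)
Fixpoint fps_inv_seq (f : nat -> rat) (n : nat) : seq rat :=
  if n is m.+1 then
    let s := fps_inv_seq f m in
    rcons s (- (f 0%N)^-1 * \sum_(i < m.+1) s`_i * f (m.+1 - i)%N)
  else [:: (f 0%N)^-1].

Definition fps_inv (f : nat -> rat) (n : nat) : rat := (fps_inv_seq f n)`_n.

(* e^x - 1 *)
Definition fps_expm1 (n : nat) : rat :=
  if n is 0%N then 0 else (n`!)%:R^-1.

(* x / (e^x - 1) is computed as the inverse of (e^x - 1) / x; by
   bernoulli_gen and bernoulli_uniq below, this sequence is the only one with
   (\sum_n B_n x^n / n!) * (e^x - 1) = x. *)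
Definition bernoulli (n : nat) : rat :=
  (n`!)%:R * fps_inv (fun m => fps_expm1 m.+1) n.

(* Extension by zero to negative indices. *)
Definition bernoulliz (i : int) : rat :=
  if i is Posz n then bernoulli n else 0.

Definition p_integral (p : nat) (x : rat) : bool := coprime p `|denq x|%N.

(* x = y (mod p^m) in the ring of p-integral rationals. *)
Definition rat_congr (p m : nat) (x y : rat) : Prop :=
  [/\ p_integral p x, p_integral p y & p_integral p ((x - y) / p%:R ^+ m)].

Lemma size_fps_inv_seq f n : size (fps_inv_seq f n) = n.+1.
Proof. by elim: n => //= n IHn; rewrite size_rcons IHn. Qed.

Lemma nth_fps_inv_seq f n i : (i <= n)%N -> (fps_inv_seq f n)`_i = fps_inv f i.
Proof.
elim: n => [|n IHn]; first by rewrite leqn0 => /eqP->.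
rewrite leq_eqVlt => /predU1P[-> // | lt_in].
by rewrite /= nth_rcons size_fps_inv_seq lt_in IHn.
Qed.

Lemma fps_mulVf f n : f 0%N != 0 -> fps_mul (fps_inv f) f n = (n == 0%N)%:R.
Proof.
move=> f0; rewrite /fps_mul big_ord_recr /= subnn.
case: n => [|n]; first by rewrite big_ord0 add0r /fps_inv /= mulVf.
rewrite {2}/fps_inv /= nth_rcons size_fps_inv_seq ltnn eqxx.
rewrite mulNr mulNr mulrAC mulVf // mul1r; apply/eqP; rewrite subr_eq0.
by apply/eqP/eq_bigr => i _; rewrite nth_fps_inv_seq // -ltnS.
Qed.

Lemma fps_mul_expm1 g n :
  fps_mul g fps_expm1 n.+1 = fps_mul g (fun m => fps_expm1 m.+1) n.
Proof.
rewrite /fps_mul big_ord_recr /= subnn mulr0 addr0.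
by apply: eq_bigr => i _; rewrite subSn // -ltnS.
Qed.

Lemma fact_rat_neq0 n : (n`!)%:R != 0 :> rat.
Proof. by rewrite pnatr_eq0 -lt0n fact_gt0. Qed.

Lemma bernoulli_gen n :
  fps_mul (fun k => bernoulli k / (k`!)%:R) fps_expm1 n = (n == 1%N)%:R.
Proof.
case: n => [|n]; first by rewrite /fps_mul big_ord1 mulr0.
rewrite fps_mul_expm1 eqSS -(@fps_mulVf (fun m => fps_expm1 m.+1)) //.
apply: eq_bigr => i _; congr (_ * _).
by rewrite /bernoulli mulrC mulKf ?fact_rat_neq0.
Qed.

Lemma bernoulli_uniq (B : nat -> rat) :
  (forall n, fps_mul (fun k => B k / (k`!)%:R) fps_expm1 n = (n == 1%N)%:R) ->
  B =1 bernoulli.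
Proof.
move=> genB n; elim/ltn_ind: n => n IHn.
have := bernoulli_gen n.+1; rewrite -genB !fps_mul_expm1 /fps_mul.
rewrite !big_ord_recr /= subnn /fps_expm1 invr1 !mulr1 => E.
apply/(mulIf (invr_neq0 (fact_rat_neq0 n)))/esym.
apply: addrI (etrans _ E); congr (_ + _).
by apply: eq_bigr => i _; rewrite IHn.
Qed.

(* Main.v *)
(* A creative-telescoping identity turns the sum over k < n into
   4 n 'C(2n, n) S(n), where S(n) is the sum over k < n of 'C(n + k - 1, k)^2,
   so for n = p^a the quantity of interest is 8 'C(2n - 1, n) S(n).

   Write 'C(n + k - 1, k) = (n / k) \prod_(i < k) (1 + n / i). For a >= 2 the
   terms of S(n) with k prime to p vanish mod p^4 and the others reduce to the
   terms of S(n / p), so that S(n) = S(n / p). Pairing i with n - i in the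
   product shows likewise that 'C(2n - 1, n) = 'C(2n / p - 1, n / p) for odd p.

   For n = p odd, let H be the sum of the 1 / k^2 and T that of the 1 / (j k^2)
   for j < k < p. Mod p^4, the binomial is 1 - p^2 H and S(p) is
   1 + p^2 H + 2 p^3 T; H cancels in the product, which leaves 1 + 2 p^3 T.
   Finally T = B_(p-3) mod p: replace the inverses by powers using Fermat, apply
   Faulhaber's formula to the inner sum, and note that a sum of m-th powers over
   0 < k < p is 0 mod p unless p - 1 divides m.

   For p = 2 it suffices that 'C(2n - 1, n) and S(n) are odd. *)
Require Import Defs.
From HB Require Import structures.
From mathcomp Require Import all_boot all_order all_algebra.
From mathcomp Require Import ring zify.

Set Implicit Arguments.
Unset Strict Implicit.
Unset Printing Implicit Defensive.

Import Order.TTheory GRing.Theory Num.Theory.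
Local Open Scope ring_scope.

(** * The ring of [p]-integral rationals and congruences modulo powers of [p] *)

Definition pint (p : nat) : {pred rat} := [pred x | p_integral p x].

(** Any denominator prime to [p] serves, not only the reduced one, so sums and products can use
    [d * e]. *)
Lemma pintP p x :
  reflect (exists2 d : nat, coprime p d & x * d%:R \is a Num.int) (x \in pint p).
Proof.
rewrite inE /p_integral; apply: (iffP idP) => [cop|[d cop /intrP[n xd]]].
  exists `|denq x|%N => //; apply/intrP; exists (numq x).
  by rewrite pmulrn gtz0_abs ?denq_gt0 // numqE.
(* Zero is coprime to [p] only when [p = 1], and then every rational is integral. *)
case: d cop xd => [|d] cop xd.
  by move: cop; rewrite /coprime gcdn0 => /eqP->; rewrite gcd1n.
apply: coprime_dvdr cop.
have {xd} : x = n%:Q / (d.+1%:Z)%:Q by rewrite -xd mulfK // pnatr_eq0.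
rewrite -[X in (_ %| X)%N]/`|d.+1%:Z|%N; case: divqP => [//|k y _ ->].
by rewrite abszM dvdn_mull.
Qed.

Fact pint_subring p : GRing.subring_closed (pint p).
Proof.
split=> [|x y|x y]; first by apply/pintP; exists 1%N; rewrite ?coprimen1 // mulr1.
all: move=> /pintP[d cd xd] /pintP[e ce ye]; apply/pintP; exists (d * e)%N.
all: rewrite ?coprimeMr ?cd ?ce // natrM.
  have -> : (x - y) * (d%:R * e%:R) = x * d%:R * e%:R - y * e%:R * d%:R by ring.
  by rewrite rpredB // rpredM ?natr_int.
by rewrite mulrACA rpredM.
Qed.

HB.instance Definition _ p := GRing.isSubringClosed.Build rat (pint p)
  (pint_subring p).

Lemma pint_inv p d : coprime p d -> d%:R^-1 \in pint p.
Proof.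
move=> cd; apply/pintP; case: d cd => [|d] cd.
  by exists 1%N; rewrite ?coprimen1 // invr0 mul0r rpred0.
by exists d.+1; rewrite // mulVf ?rpred1 // pnatr_eq0.
Qed.

Lemma pint_invn p d : prime p -> ~~ (p %| d)%N -> d%:R^-1 \in pint p.
Proof. by move=> pp pd; rewrite pint_inv // prime_coprime. Qed.

(** An explicit quotient turns the rules below into identities between witnesses; [pcong_rat_congr]
    returns to [rat_congr]. *)
Definition pcong (p m : nat) (x y : rat) : Prop :=
  exists2 z, z \in pint p & x = y + p%:R ^+ m * z.

Section Congruence.
Variable p : nat.
Implicit Types (m k : nat) (x y z t : rat).

Lemma pcong_refl m x : pcong p m x x.
Proof. by exists 0; rewrite ?rpred0 // mulr0 addr0. Qed.

Lemma pcong_sym m x y : pcong p m x y -> pcong p m y x.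
Proof. by move=> [z pz ->]; exists (- z); rewrite ?rpredN // mulrN addrK. Qed.

Lemma pcong_trans m x y z : pcong p m x y -> pcong p m y z -> pcong p m x z.
Proof.
by move=> [t pt ->] [u pu ->]; exists (u + t); rewrite ?rpredD // mulrDr addrA.
Qed.

Lemma pcongW k m x y : (k <= m)%N -> pcong p m x y -> pcong p k x y.
Proof.
move=> km [z pz ->]; exists (p%:R ^+ (m - k) * z).
  by rewrite rpredM ?rpredX ?rpred_nat.
by rewrite mulrA -exprD subnKC.
Qed.

Lemma pcongD m x y z t :
  pcong p m x y -> pcong p m z t -> pcong p m (x + z) (y + t).
Proof.
move=> [u pu ->] [v pv ->]; exists (u + v); first exact: rpredD.
by rewrite mulrDr addrACA.
Qed.

Lemma pcongMl m x y z : z \in pint p -> pcong p m x y -> pcong p m (z * x) (z * y).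
Proof.
move=> pz [u pu ->]; exists (z * u); first exact: rpredM.
by rewrite mulrDr mulrCA.
Qed.

Lemma pcong_pint m x y : pcong p m x y -> y \in pint p -> x \in pint p.
Proof. by move=> [z pz ->] py; rewrite rpredD ?rpredM ?rpredX ?rpred_nat. Qed.

Lemma pcongM m x y z t : y \in pint p -> t \in pint p ->
  pcong p m x y -> pcong p m z t -> pcong p m (x * z) (y * t).
Proof.
move=> py pt xy zt; apply: (@pcong_trans _ _ (x * t)).
  exact: pcongMl (pcong_pint xy py) zt.
by rewrite ![_ * t]mulrC; apply: pcongMl.
Qed.

Lemma pcongX m x y k : y \in pint p -> pcong p m x y -> pcong p m (x ^+ k) (y ^+ k).
Proof.
move=> py xy; elim: k => [|k IHk]; first exact: pcong_refl.
by rewrite !exprS; apply: pcongM; rewrite ?rpredX.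
Qed.

Lemma pcong_scale k m x y :
  pcong p m x y -> pcong p (k + m) (p%:R ^+ k * x) (p%:R ^+ k * y).
Proof. by move=> [z pz ->]; exists z; rewrite // exprD mulrDr mulrA. Qed.

Lemma pcong_sum (I : Type) (r : seq I) (P : pred I) (F G : I -> rat) m :
  (forall i, P i -> pcong p m (F i) (G i)) ->
  pcong p m (\sum_(i <- r | P i) F i) (\sum_(i <- r | P i) G i).
Proof.
move=> FG; apply: (big_ind2 (pcong p m)) => //; first exact: pcong_refl.
by move=> *; apply: pcongD.
Qed.

(** A product of two terms [p ^ m * F i] carries [p ^ (m + m)], so only the linear part survives. *)
Lemma pcong_prod1D (I : Type) (r : seq I) (P : pred I) (F : I -> rat) m :
  (forall i, P i -> F i \in pint p) ->
  pcong p (m + m) (\prod_(i <- r | P i) (1 + p%:R ^+ m * F i))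
                  (1 + p%:R ^+ m * \sum_(i <- r | P i) F i).
Proof.
move=> pF; elim: r => [|i r IHr]; first by rewrite !big_nil mulr0 addr0;
  apply: pcong_refl.
rewrite !big_cons; case: ifP => Pi //.
have pS : \sum_(j <- r | P j) F j \in pint p by rewrite rpred_sum.
have pp : p%:R ^+ m \in pint p by rewrite rpredX ?rpred_nat.
apply: pcong_trans (pcongMl _ IHr) _; first by rewrite rpredD ?rpred1 ?rpredM ?pF.
exists (F i * \sum_(j <- r | P j) F j); first by rewrite rpredM ?pF.
by rewrite exprD; ring.
Qed.

Lemma pcong_rat_congr m x y : (0 < p)%N -> y \in pint p -> pcong p m x y ->
  rat_congr p m x y.
Proof.
move=> p0 py xy; split=> //; first exact: pcong_pint xy py.
case: xy => z pz ->; rewrite addrC addKr mulrC mulKf //.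
by rewrite expf_neq0 // pnatr_eq0 -lt0n.
Qed.

(** For odd [p], [x + y] is 2 modulo [p], hence a unit, so the powers of [p] in [(x - y) * (x + y)]
    pass to [x - y], one per induction step. *)
Lemma pcong_sqr m x y : prime p -> odd p ->
  pcong p 1 x 1 -> pcong p 1 y 1 -> pcong p m (x ^+ 2) (y ^+ 2) -> pcong p m x y.
Proof.
move=> pp op [u pu xu] [v pv yv]; elim: m => [|m IHm] sqr.
  exists (x - y); last by rewrite expr0 mul1r addrC subrK.
  by rewrite xu yv rpredB // rpredD ?rpred1 // rpredM ?rpredX ?rpred_nat.
have [w pw xyw] := IHm (pcongW (leqnSn m) sqr); case: sqr => t pt.
have p2 : (2%:R : rat)^-1 \in pint p by rewrite pint_inv // coprimen2.
(* The witness solves [p ^ m * w * (2 + p * (u + v)) = p ^ m.+1 * t] for [p ^ m * w], where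
   [x - y = p ^ m * w]. *)
move=> E; exists (2^-1 * (t - (u + v) * w)).
  by rewrite rpredM ?rpredB ?rpredM ?rpredD.
have {}E : p%:R ^+ m * w * (2 + p%:R * (u + v)) = p%:R ^+ m.+1 * t.
  apply: (addrI (y ^+ 2)); rewrite -E -[p%:R ^+ m * w](addKr y) -xyw.
  by rewrite [in X in _ + X](_ : 2 + _ = x + y) ?xu ?yv; ring.
have -> : p%:R ^+ m.+1 * (2^-1 * (t - (u + v) * w)) =
          2^-1 * (p%:R ^+ m.+1 * t - p%:R ^+ m.+1 * (u + v) * w) by ring.
by rewrite -E xyw exprS; field.
Qed.

End Congruence.

(** * Binomial identities: the telescoped sum and the product formula *)

Lemma mul_bin_predS n k : (k.+1 * 'C((n + k.+1).-1, k.+1) = n * 'C(n + k, k))%N.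
Proof. by rewrite addnS mul_bin_left addnK. Qed.

Lemma mul_bin_central n :
  n.+1%:R * 'C(2 * n.+1, n.+1)%:R = 2 * (2 * n%:R + 1) * 'C(2 * n, n)%:R :> rat.
Proof.
have E1 := mul_bin_diag (2 * n).+1 n; have E2 := mul_bin_left (2 * n) n.
have E3 : ('C((2 * n).+2, n.+1) = 2 * 'C((2 * n).+1, n.+1))%N.
  rewrite binS -[in X in (_ + X)%N]bin_sub; last by lia.
  by rewrite (_ : ((2 * n).+1 - n = n.+1)%N) ?mul2n ?addnn //; lia.
rewrite mulnS (_ : (2 + 2 * n = (2 * n).+2)%N) // E3 natrM.
move: E1 => /= /(congr1 (fun m => m%:R : rat)); rewrite !natrM => E1.
by rewrite mulrCA -E1 -[(2 * n).+1]addn1 natrD natrM; ring.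
Qed.

(** This is S(n) of the overview. *)
Definition sqbin_sum n : rat := \sum_(0 <= k < n) 'C((n + k).-1, k)%:R ^+ 2.

(* The certificate [(2 k + 3 n) 'C(n + k - 1, n) ^ 2] comes from Zeilberger's
   algorithm. *)
Lemma sqbin_sum_telescope m k (n := m.+1) :
  2 * (2 * n%:R + 1) * 'C(n + k, k)%:R ^+ 2 - n%:R * 'C((n + k).-1, k)%:R ^+ 2 =
  (2 * k.+1%:R + 3 * n%:R) * 'C((n + k.+1).-1, n)%:R ^+ 2
    - (2 * k%:R + 3 * n%:R) * 'C((n + k).-1, n)%:R ^+ 2 :> rat.
Proof.
rewrite /n addSn addnS /=.
have -> : 'C((m + k).+1, k) = 'C((m + k).+1, m.+1).
  by rewrite -[RHS]bin_sub ?subSS ?addKn //; lia.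
have -> : 'C(m + k, k) = 'C(m + k, m).
  by rewrite -[RHS]bin_sub ?addKn //; lia.
have := mul_bin_left (m + k) m; rewrite addKn => /(congr1 (fun m => m%:R : rat)).
rewrite binS natrD !natrM -[m.+1]addn1 -[k.+1]addn1 !natrD.
move: ('C(_, m + 1)%:R) ('C(_, m)%:R) => B D E.
apply/eqP; rewrite -subr_eq0; apply/eqP.
(* In terms of [B = 'C(m + k, m + 1)] and [D = 'C(m + k, m)] the difference of the two sides
   factors, and its first factor is zero by [E]. *)
transitivity (((m%:R + 1) * B - k%:R * D) * (4 * B + 2 * D));
  last by rewrite E subrr mul0r.
by ring.
Qed.

(** Summing the telescoping identity over [k < n] gives 2(2n + 1) S(n + 1) - n S(n) = (21n + 8)/4
    'C(2n, n)^2. Multiplied by 4 'C(2n, n), this is the induction step. *)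
Lemma sum_cube_central_bin n :
  \sum_(0 <= k < n) (21 * k + 8)%:R * 'C(2 * k, k)%:R ^+ 3 =
  4 * n%:R * 'C(2 * n, n)%:R * sqbin_sum n.
Proof.
elim: n => [|[|m] IHn]; first by rewrite big_geq // mulr0 !mul0r.
  by rewrite /sqbin_sum !big_nat1; vm_compute; apply/eqP.
rewrite big_nat_recr //= {}IHn; set n := m.+1.
have := telescope_sumr (fun k =>
  (2 * k%:R + 3 * n%:R) * 'C((n + k).-1, n)%:R ^+ 2 : rat) (leq0n n).
under eq_bigr => k _ do rewrite -sqbin_sum_telescope.
rewrite sumrB -!mulr_sumr -/(sqbin_sum n) [(n + 0)%N]addn0.
(* The lower boundary term contains ['C(n - 1, n) = 0]. *)
rewrite [X in _ = _ - X](_ : _ = 0) ?subr0; last by rewrite bin_small // expr0n mulr0.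
have -> : \sum_(0 <= k < n) 'C(n + k, k)%:R ^+ 2 =
  sqbin_sum n.+1 - 'C(2 * n, n)%:R ^+ 2 :> rat.
  by rewrite /sqbin_sum [in RHS]big_nat_recr //= addnn mul2n addrK.
have -> : 'C((n + n).-1, n)%:R = 'C(2 * n, n)%:R / 2 :> rat.
  rewrite mul2n -addnn /n addSn /= binS.
  rewrite (_ : 'C(m + m.+1, m) = 'C(m + m.+1, m.+1)) ?natrD;
    last by rewrite -[RHS]bin_sub ?addnK //; lia.
  by field.
have := mul_bin_central n.
rewrite -/n -[n.+1]addn1 natrD [(21 * n + 8)%:R]natrD natrM.
move: (n%:R) (sqbin_sum n) (sqbin_sum _) ('C(2 * n, _)%:R) ('C(_, _)%:R) =>
  N S0 S1 C C1 E1 E2.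
transitivity (4 * (2 * (2 * N + 1) * C) * S1); last by rewrite -E1; ring.
apply/eqP; rewrite -subr_eq0; apply/eqP; move/eqP: E2; rewrite -subr_eq0 => /eqP E2.
transitivity (- (4 * C) * 0 : rat); last by rewrite mulr0.
by rewrite -E2; field.
Qed.

(* The factor at [i = 0] is [1], because [x / 0 = 0]. *)
Lemma bin_prodE n k : (0 < k)%N ->
  'C((n + k).-1, k)%:R = n%:R / k%:R * \prod_(0 <= i < k) (1 + n%:R / i%:R) :> rat.
Proof.
case: k => // k _; elim: k => [|k IHk].
  by rewrite big_nat1 invr0 mulr0 addr0 mulr1 addn1 bin1 divr1.
have := mul_bin_diag (n + k.+1) k.+1 => /(congr1 (fun m => m%:R : rat)).
rewrite !natrM {}IHk [(n + k.+2)%N]addnS /= => E.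
apply: (@mulfI _ k.+2%:R); first by rewrite pnatr_eq0.
rewrite -E natrD [in RHS]big_nat_recr //=; move: (\prod_(_ <= _ < _) _) => P.
by field; rewrite nat1r -natrD !pnatr_eq0.
Qed.

(** * Splitting by divisibility by [p], and descent from [p ^ a.+1] to [p ^ a] *)

Lemma big_nat_dvd (R : Type) (idx : R) (op : Monoid.law idx) p k (F : nat -> R) :
  (0 < p)%N ->
  \big[op/idx]_(0 <= i < p * k | (p %| i)%N) F i =
  \big[op/idx]_(0 <= j < k) F (p * j)%N.
Proof.
move=> p0; elim: k => [|k IHk]; first by rewrite muln0 !big_geq.
rewrite (@big_cat_nat _ _ _ (p * k)) //=; last by rewrite leq_mul2l leqnSn orbT.
rewrite IHk big_nat_recr //=; congr (op _ _).
rewrite big_ltn_cond ?ltn_pmul2l // dvdn_mulr // big_nat_cond big1 ?Monoid.mulm1 //.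
move=> i /andP[/andP[lo hi] /dvdnP[j ij]]; move: lo hi.
by rewrite ij (mulnC j) ltn_pmul2l // ltn_pmul2l // ltnS => lo /(leq_trans lo);
  rewrite ltnn.
Qed.

(** In the product formula the factor at [i = p * j] is [1 + n / j]; these factors rebuild the
    smaller binomial. *)
Lemma bin_mul_prodE p n k : (0 < p)%N -> (0 < k)%N ->
  'C((p * n + p * k).-1, p * k)%:R =
  'C((n + k).-1, k)%:R *
    \prod_(0 <= i < p * k | ~~ (p %| i)%N) (1 + (p * n)%:R / i%:R) :> rat.
Proof.
move=> p0 k0; have pn0 : p%:R != 0 :> rat by rewrite pnatr_eq0 -lt0n.
rewrite !bin_prodE ?muln_gt0 ?p0 // (bigID (fun i => (p %| i)%N)) /= big_nat_dvd //.
rewrite mulrA; congr (_ * _); rewrite !natrM -mulf_div divff // mul1r; congr (_ * _).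
by apply: eq_bigr => i _; rewrite natrM -mulf_div divff // mul1r.
Qed.

Lemma pcong_prod1 p m (I : Type) (r : seq I) (P : pred I) (F : I -> rat) :
  (forall i, P i -> pcong p m (F i) 1) -> pcong p m (\prod_(i <- r | P i) F i) 1.
Proof.
move=> F1; apply: (big_ind (fun x => pcong p m x 1)) => //; first exact: pcong_refl.
move=> x y x1 y1; rewrite -[X in pcong _ _ _ X]mulr1.
by apply: pcongM; rewrite ?rpred1.
Qed.

Lemma pcong_sum0 p m (I : Type) (r : seq I) (P : pred I) (F : I -> rat) :
  (forall i, P i -> pcong p m (F i) 0) -> pcong p m (\sum_(i <- r | P i) F i) 0.
Proof.
move=> F0; apply: (big_ind (fun x => pcong p m x 0)) => //; first exact: pcong_refl.
by move=> x y x0 y0; rewrite -[X in pcong _ _ _ X]addr0; apply: pcongD.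
Qed.

Section PrimePower.
Variable p : nat.
Hypothesis pp : prime p.

Let p0 : (0 < p)%N. Proof. exact: prime_gt0. Qed.
Let pn0 : p%:R != 0 :> rat. Proof. by rewrite pnatr_eq0 -lt0n. Qed.

(** A positive [i < p ^ a] has [p]-adic valuation [v < a], so the quotient keeps a factor [p]. *)
Lemma ppow_div_pcong0 a i : (i < p ^ a)%N -> pcong p 1 ((p ^ a)%:R / i%:R) 0.
Proof.
case: i => [|i] lti; first by rewrite invr0 mulr0; apply: pcong_refl.
have [v [u pu ij]] : exists v, exists2 u, ~~ (p %| u)%N & i.+1 = (u * p ^ v)%N.
  have [u pu iE] := pfactor_coprime pp (ltn0Sn i).
  by exists (logn p i.+1), u; rewrite // -prime_coprime.
have u0 : u%:R != 0 :> rat by rewrite pnatr_eq0; apply: contraNneq pu => ->.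
have va : (v < a)%N.
  rewrite -(ltn_exp2l _ _ (prime_gt1 pp)) (leq_ltn_trans _ lti) // ij leq_pmull //.
  by rewrite lt0n; apply: contraNneq pu => ->.
exists (p%:R ^+ (a - v.+1) * u%:R^-1).
  by rewrite rpredM ?rpredX ?rpred_nat // pint_invn.
rewrite add0r mulrA -exprD (_ : (1 + (a - v.+1) = a - v)%N); last by lia.
rewrite ij natrM !natrX invfM mulrCA mulrC; congr (_ * _).
by rewrite -{1}(subnK (ltnW va)) exprD mulfK // expf_neq0.
Qed.

Lemma prod_pcong1 a k : (k <= p ^ a)%N ->
  pcong p 1 (\prod_(0 <= i < k) (1 + (p ^ a)%:R / i%:R)) 1.
Proof.
move=> ka; rewrite big_nat; apply: pcong_prod1 => i /andP[_ ik].
rewrite -[X in pcong _ _ _ X]addr0; apply: pcongD; first exact: pcong_refl.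
exact: ppow_div_pcong0 (leq_trans ik ka).
Qed.

Lemma bin_ppow_pcong0 a k : (0 < k < p ^ a)%N ->
  pcong p 1 'C((p ^ a + k).-1, k)%:R 0.
Proof.
case/andP=> k0 ka; rewrite bin_prodE // -(mul0r 1).
by apply: pcongM; rewrite ?rpred0 ?rpred1 //;
  [exact: ppow_div_pcong0|exact/prod_pcong1/ltnW].
Qed.

Lemma central_bin_pcong1 a : pcong p 1 'C((p ^ a + p ^ a).-1, p ^ a)%:R 1.
Proof.
rewrite bin_prodE ?expn_gt0 ?p0 // divff ?mul1r; first exact: prod_pcong1.
by rewrite pnatr_eq0 -lt0n expn_gt0 p0.
Qed.

(** Modulo [p] only the term [k = 0] survives; this and [central_bin_pcong1] serve the case
    [p = 2]. *)
Lemma sqbin_sum_pcong1 a : pcong p 1 (sqbin_sum (p ^ a)) 1.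
Proof.
rewrite /sqbin_sum big_ltn ?expn_gt0 ?p0 // bin0 expr1n.
rewrite -[X in pcong _ _ _ X]addr0; apply: pcongD; first exact: pcong_refl.
rewrite big_nat; apply: pcong_sum0 => i /bin_ppow_pcong0 i0.
by have := pcongX 2 (rpred0 _) i0; rewrite expr0n.
Qed.

Lemma coprime_prod_pcong1 a k :
  pcong p a (\prod_(0 <= i < k | ~~ (p %| i)%N) (1 + (p ^ a)%:R / i%:R)) 1.
Proof.
apply: pcong_prod1 => i pi; exists i%:R^-1; first exact: pint_invn.
by rewrite natrX.
Qed.

Lemma sqbin_sum_reduce a : (0 < a)%N ->
  pcong p 4 (sqbin_sum (p ^ a.+1)) (sqbin_sum (p ^ a)).
Proof.
move=> a0; rewrite /sqbin_sum (bigID (fun k => (p %| k)%N)) /=.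
rewrite [X in pcong _ _ _ X](_ : _ =
  \sum_(0 <= k < p ^ a) 'C((p ^ a + k).-1, k)%:R ^+ 2 + 0); last by rewrite addr0.
apply: pcongD; last first.
  apply: pcong_sum0 => -[|k]; first by rewrite dvdn0.
  move=> pk; have k0 : k.+1%:R != 0 :> rat by rewrite pnatr_eq0.
  (* The factor [n / k] carries [p ^ a.+1] with [a.+1 >= 2], so the square vanishes modulo
     [p ^ 4]. *)
  have -> : 'C((p ^ a.+1 + k.+1).-1, k.+1)%:R =
      p%:R ^+ a.+1 * (k.+1%:R^-1 * 'C(p ^ a.+1 + k, k)%:R) :> rat.
    apply: (mulfI k0); rewrite -natrM mul_bin_predS natrM natrX.
    by rewrite mulrCA (mulrA _ _^-1) divff // mul1r.
  exists ((p%:R ^+ (a - 1) * (k.+1%:R^-1 * 'C(p ^ a.+1 + k, k)%:R)) ^+ 2).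
    by rewrite rpredX // rpredM ?rpredX ?rpred_nat // rpredM ?rpred_nat // pint_invn.
  rewrite add0r (_ : a.+1 = 2 + (a - 1))%N; last by lia.
  by rewrite exprD; ring.
rewrite expnS big_nat_dvd // big_nat [X in pcong _ _ _ X]big_nat.
apply: pcong_sum => -[|k] /= ka; first by rewrite muln0 !bin0; apply: pcong_refl.
rewrite bin_mul_prodE // -expnS.
(* The smaller binomial is [p * c]; its square supplies [p ^ 2], so the remaining product is needed
   only modulo [p ^ 2]. *)
have [c pc ->] := @bin_ppow_pcong0 a k.+1 ka; rewrite add0r.
have U1 := pcongX 2 (rpred1 _)
  (pcongW (a0 : 1 < a.+1)%N (coprime_prod_pcong1 a.+1 (p * k.+1))).
rewrite exprMn [X in pcong _ _ _ X](_ : _ = (p%:R ^+ 1 * c) ^+ 2 * 1 ^+ 2);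
  last by rewrite expr1n mulr1.
have E x : (p%:R ^+ 1 * c) ^+ 2 * x = p%:R ^+ 2 * (c ^+ 2 * x) by ring.
rewrite !E; apply: (@pcong_scale p 2 2); apply: pcongMl => //.
by rewrite rpredX.
Qed.

(** Reversing one copy of the product pairs [i] with [n - i], and (1 + n/i)(1 + n/(n - i)) = 1 +
    2n^2/(i(n - i)). Squaring avoids splitting the range in half. *)
Lemma coprime_prod_sqr a (n := (p ^ a)%N) : (0 < a)%N ->
  pcong p (a + a + (a + a))
    ((\prod_(0 <= i < n | ~~ (p %| i)%N) (1 + n%:R / i%:R)) ^+ 2)
    (1 + n%:R ^+ 2 * \sum_(1 <= i < n | ~~ (p %| i)%N) 2 / (i%:R * (n - i)%:R)).
Proof.
move=> a0; have n0 : (0 < n)%N by rewrite expn_gt0 p0.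
have pn : (p %| n)%N by rewrite dvdn_exp.
rewrite big_ltn_cond // dvdn0 /= expr2 {2}big_nat_rev /=.
have -> : \prod_(1 <= i < n | ~~ (p %| 1 + n - i.+1)%N) (1 + n%:R / (1 + n - i.+1)%:R) =
  \prod_(1 <= i < n | ~~ (p %| i)%N) (1 + n%:R / (n - i)%:R) :> rat.
  rewrite big_nat_cond [RHS]big_nat_cond; apply: eq_big => i;
    last by rewrite add1n subSS.
  by case: (boolP (1 <= i < n)%N) => //= /andP[_ /ltnW lei];
    rewrite add1n subSS dvdn_subr.
rewrite -big_split /=.
have -> : n%:R ^+ 2 = p%:R ^+ (a + a) :> rat by rewrite natrX exprD expr2.
rewrite big_nat_cond [in X in pcong _ _ _ X]big_nat_cond.
under eq_bigr => i /andP[/andP[i0 iltn] pi].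
  have -> : (1 + n%:R / i%:R) * (1 + n%:R / (n - i)%:R) =
    1 + p%:R ^+ (a + a) * (2 / (i%:R * (n - i)%:R)) :> rat.
    have -> : p%:R ^+ (a + a) = n%:R ^+ 2 :> rat by rewrite natrX exprD expr2.
    have i1 : i%:R != 0 :> rat by rewrite pnatr_eq0 -lt0n.
    have i2 : n%:R - i%:R != 0 :> rat by rewrite subr_eq0 eqr_nat gtn_eqF.
    by rewrite natrB ?(ltnW iltn) //; field; rewrite i1 i2.
  over.
apply: pcong_prod1D => i /andP[/andP[i0 iltn] pi].
rewrite rpredM ?rpred_nat // invfM rpredM ?pint_invn //.
by rewrite dvdn_subr // ltnW.
Qed.

(** The two binomials differ by the product over [i] prime to [p]. Its square is 1 modulo
    [p ^ (2 * a.+1)], hence modulo [p ^ 4], and [pcong_sqr] removes the square. *)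
Lemma central_bin_reduce a : odd p -> (0 < a)%N ->
  pcong p 4 'C((p ^ a.+1 + p ^ a.+1).-1, p ^ a.+1)%:R 'C((p ^ a + p ^ a).-1, p ^ a)%:R.
Proof.
move=> op a0; rewrite expnS bin_mul_prodE // ?expn_gt0 ?p0 // -expnS.
rewrite -[X in pcong _ _ _ X]mulr1; apply: pcongMl; first exact: rpred_nat.
apply: pcong_sqr => //; first by apply: pcongW (coprime_prod_pcong1 _ _).
  exact: pcong_refl.
rewrite expr1n; apply: pcong_trans (pcongW _ (coprime_prod_sqr _)) _ => //;
  first by lia.
exists (p%:R ^+ (2 * a - 2) *
  \sum_(1 <= i < p ^ a.+1 | ~~ (p %| i)%N) 2 / (i%:R * (p ^ a.+1 - i)%:R)).
  rewrite rpredM ?rpredX ?rpred_nat // big_nat_cond rpred_sum // =>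
    i /andP[/andP[i0 ilt] pi].
  rewrite rpredM ?rpred_nat // invfM rpredM ?pint_invn //.
  by rewrite dvdn_subr ?dvdn_exp // ltnW.
by rewrite mulrA -exprD natrX -exprM; congr (_ + _ ^+ _ * _); lia.
Qed.

End PrimePower.

(** * Bernoulli numbers and Faulhaber's formula *)

(** Coefficient of [x ^ n] in the generating identity, times [n!]. *)
Lemma bernoulli_sum n :
  \sum_(0 <= i < n) 'C(n, i)%:R * bernoulli i = (n == 1%N)%:R.
Proof.
have := congr1 (fun x => (n`!)%:R * x) (bernoulli_gen n).
rewrite /fps_mul big_ord_recr /= subnn mulr0 addr0 mulr_sumr big_mkord => E.
transitivity ((n`!)%:R * (n == 1%N)%:R : rat); last by case: eqP => [->|];
  rewrite ?mulr0 ?mulr1.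
rewrite -E; apply: eq_bigr => i _.
have -> : fps_expm1 (n - i) = ((n - i)`!)%:R^-1 by move: (ltn_ord i);
  rewrite -subn_gt0; case: (n - i)%N.
rewrite -(bin_fact (ltnW (ltn_ord i))) !natrM.
by field; rewrite !fact_rat_neq0.
Qed.

(** Both sides are the trinomial coefficient n!/(i! l! (n - i - l)!). *)
Lemma mul_bin_swap n i l : (i + l <= n)%N ->
  ('C(n, i) * 'C(n - i, l) = 'C(n, l) * 'C(n - l, i))%N.
Proof.
move=> il; have f0 m := fact_gt0 m.
have E1 := bin_fact (leq_trans (leq_addr l i) il).
have E2 := bin_fact (leq_trans (leq_addl i l) il).
have E3 : ('C(n - i, l) * (l`! * (n - i - l)`!) = (n - i)`!)%N by apply: bin_fact; lia.
have E4 : ('C(n - l, i) * (i`! * (n - l - i)`!) = (n - l)`!)%N by apply: bin_fact; lia.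
rewrite subnAC in E4; rewrite -E3 in E1; rewrite -E4 -E1 in E2.
have F0 : (0 < i`! * (l`! * (n - i - l)`!))%N by rewrite !muln_gt0 !f0.
apply/eqP; rewrite -(eqn_pmul2r F0); apply/eqP.
transitivity ('C(n, i) * (i`! * ('C(n - i, l) * (l`! * (n - i - l)`!))))%N;
  first by ring.
by rewrite -E2; ring.
Qed.

Lemma exprD1B (R : comPzRingType) (x : R) n :
  (x + 1) ^+ n - x ^+ n = \sum_(0 <= l < n) 'C(n, l)%:R * x ^+ l.
Proof.
rewrite (addrC x) exprDn big_ord_recr /= subnn expr0 binn mulr1n mul1r addrK big_mkord.
by apply: eq_bigr => i _; rewrite expr1n mul1r mulr_natl.
Qed.

(** The difference equation of the Bernoulli polynomial of degree [n.+1], whose constant term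
    cancels. After expansion and exchange of sums, the coefficient of [x ^ l] contains
    [bernoulli_sum (n.+1 - l)], nonzero only for [l = n]. *)
Lemma bernoulli_diff n (x : rat) :
  \sum_(0 <= i < n.+1) 'C(n.+1, i)%:R * bernoulli i *
     ((x + 1) ^+ (n.+1 - i) - x ^+ (n.+1 - i)) = n.+1%:R * x ^+ n.
Proof.
transitivity (\sum_(0 <= i < n.+1) \sum_(0 <= l < n.+1 | (i + l < n.+1)%N)
   'C(n.+1, l)%:R * x ^+ l * ('C(n.+1 - l, i)%:R * bernoulli i)).
  apply: eq_bigr => i _; rewrite exprD1B mulr_sumr.
  rewrite (big_nat_widen _ _ n.+1) ?leq_subr //; apply: eq_big => [l|l lt] /=;
    first by lia.
  have /mul_bin_swap/(congr1 (fun m => m%:R : rat)) : (i + l <= n.+1)%N by lia.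
  by rewrite !natrM => E; rewrite mulrACA E; ring.
have W m F : (m <= n.+1)%N -> \sum_(0 <= i < n.+1 | (i < m)%N) F i =
  \sum_(0 <= i < m) F i :> rat.
  by move=> mn; rewrite [RHS](big_nat_widen _ _ n.+1).
rewrite (exchange_big_dep_nat xpredT) //= big_nat_recr //= big_nat big1 =>
  [|l /andP[_ ln]].
  rewrite add0r -mulr_sumr (eq_bigl (fun i => i < 1)%N); last by move=> i; lia.
  rewrite W // big_nat1 bin0.
  by have := bernoulli_sum 1; rewrite big_nat1 bin0 mul1r => ->; rewrite binSn !mulr1.
rewrite -mulr_sumr (eq_bigl (fun i => i < n.+1 - l)%N); last by move=> i; lia.
rewrite W ?leq_subr // bernoulli_sum.
by rewrite (_ : (_ == _) = false) ?mulr0 //; lia.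
Qed.

Lemma faulhaber m k :
  m.+1%:R * \sum_(0 <= j < k) j%:R ^+ m =
  \sum_(0 <= i < m.+1) 'C(m.+1, i)%:R * bernoulli i * k%:R ^+ (m.+1 - i) :> rat.
Proof.
elim: k => [|k IHk].
  rewrite big_geq // mulr0 big_nat big1 // => i /andP[_ im].
  by rewrite expr0n subn_eq0 leqNgt im mulr0.
rewrite big_nat_recr //= mulrDr IHk -bernoulli_diff -big_split /=.
by apply: eq_bigr => i _; rewrite -natr1; ring.
Qed.

(** * Bernoulli numbers and power sums modulo [p] *)

Section PrimeModulus.
Variable p : nat.
Hypothesis pp : prime p.

(** The recurrence for the [i]-th Bernoulli number divides only by [i.+1], which is prime to [p]. *)
Lemma bernoulli_pint i : (i.+1 < p)%N -> bernoulli i \in pint p.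
Proof.
elim/ltn_ind: i => i IHi ip.
have := bernoulli_sum i.+1; rewrite big_nat_recr //= binSn => E.
have i0 : i.+1%:R != 0 :> rat by rewrite pnatr_eq0.
rewrite -(mulKf i0 (bernoulli i)) (canRL (addKr _) E).
rewrite rpredM ?pint_invn ?gtnNdvd // addrC rpredB ?rpred_nat // big_nat rpred_sum //
  => j /andP[_ ji].
by rewrite rpredM ?rpred_nat ?IHi //; lia.
Qed.

(** Faulhaber's formula at [k = p]: each term has a factor [p], and [m.+1] is invertible. *)
Lemma sum_pow_pcong0 m : (m.+1 < p)%N -> pcong p 1 (\sum_(0 <= j < p) j%:R ^+ m) 0.
Proof.
move=> mp; have m0 : m.+1%:R != 0 :> rat by rewrite pnatr_eq0.
rewrite -(mulKf m0 (\sum_(_ <= _ < _) _)) faulhaber.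
rewrite -[X in pcong _ _ _ X](mulr0 (m.+1%:R^-1)).
apply: pcongMl; first by rewrite pint_invn // gtnNdvd.
rewrite big_nat; apply: pcong_sum0 => i /andP[_ im].
exists ('C(m.+1, i)%:R * bernoulli i * p%:R ^+ (m - i)).
  have pb : bernoulli i \in pint p by apply: bernoulli_pint; lia.
  by apply: rpredM; [apply: rpredM; rewrite ?rpred_nat|rewrite rpredX ?rpred_nat].
by rewrite add0r [RHS]mulrCA -exprD; congr (_ * _ ^+ _); lia.
Qed.

Lemma fermat_pcong k : (0 < k < p)%N -> pcong p 1 (k%:R ^+ p.-1) 1.
Proof.
case/andP=> k0 kp; have p0 := prime_gt0 pp.
have kn0 : k%:R != 0 :> rat by rewrite pnatr_eq0 -lt0n.
have /eqP := fermat_little k pp; rewrite eqn_mod_dvd;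
  last by rewrite -{1}(expn1 k) leq_pexp2l.
case/dvdnP=> t E; exists (k%:R^-1 * t%:R).
  by rewrite rpredM ?rpred_nat // pint_invn // gtnNdvd.
apply: (mulfI kn0); rewrite -exprS prednK // mulrDr expr1 mulrCA mulVKf //.
by rewrite mulr1 -natrM mulnC -E -natrX -natrD subnKC // -{1}(expn1 k) leq_pexp2l.
Qed.

Lemma pcong_inv k d e : (0 < k < p)%N -> (d + e = p.-1)%N ->
  pcong p 1 (k%:R ^- d) (k%:R ^+ e).
Proof.
move=> kp de; apply: pcong_sym; case/andP: (kp) => k0 kltp.
have kn0 : k%:R != 0 :> rat by rewrite pnatr_eq0 -lt0n.
rewrite -[X in pcong _ _ X](mulKf (expf_neq0 d kn0)) -exprD de.
rewrite -[X in pcong _ _ _ X]mulr1; apply: pcongMl (fermat_pcong kp).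
by rewrite -exprVn rpredX // pint_invn // gtnNdvd.
Qed.

(** The exponent runs from [p - 2] to [2p - 4], where [p - 1] (at [e = 2]) is the only multiple of
    [p - 1]. *)
Lemma sum_pow_pcong q e : p = q.+3 -> (0 < e <= q.+2)%N ->
  pcong p 1 (\sum_(1 <= k < p) k%:R ^+ (q + e)) (if e == 2 then -1 else 0).
Proof.
move=> pq; case: e => [//|[|[|e]]] /= eq.
- have := @sum_pow_pcong0 q.+1;
  rewrite addn1 (@big_ltn _ _ _ 0) ?prime_gt0 // expr0n add0r.
  by apply; lia.
- apply: (@pcong_trans _ _ _ (\sum_(1 <= k < p) 1)).
    rewrite big_nat [X in pcong _ _ _ X]big_nat; apply: pcong_sum => k kp.
    by rewrite (_ : q + 2 = p.-1)%N; [exact: fermat_pcong|lia].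
  exists 1; rewrite ?rpred1 // expr1 mulr1 big_const_nat iter_addr_0.
  by rewrite natrB ?prime_gt0 // addrC.
- have := @sum_pow_pcong0 e.+1;
  rewrite (@big_ltn _ _ _ 0) ?prime_gt0 // expr0n add0r => S0.
  apply: pcong_trans (S0 _); last by lia.
  rewrite big_nat [X in pcong _ _ _ X]big_nat; apply: pcong_sum => k kp.
  rewrite (_ : q + e.+3 = p.-1 + e.+1)%N; last by lia.
  rewrite exprD -[X in pcong _ _ _ X]mul1r.
  by apply: pcongM; rewrite ?rpred1 ?rpredX ?rpred_nat //;
    [exact: fermat_pcong|exact: pcong_refl].
Qed.

End PrimeModulus.

(** * Odd primes [p = q + 3]: the case [n = p], then all powers *)

Section OddPrime.
Variables p q : nat.
Hypotheses (pp : prime p) (pq : p = q.+3).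

Let op : odd p.
Proof. by case: (even_prime pp) => // p2; move: pq; rewrite p2. Qed.

Let p0 : (0 < p)%N. Proof. exact: prime_gt0. Qed.

Let pint_half : 2^-1 \in pint p.
Proof. by rewrite pint_inv // coprimen2. Qed.

(** At [n = p] this is T of the overview, and [harm2] is H; the index [i = 0] contributes
    [0^-1 = 0]. *)
Definition dharm (n : nat) : rat :=
  \sum_(1 <= k < n) k%:R ^- 2 * \sum_(0 <= i < k) i%:R^-1.

Definition harm2 (n : nat) : rat := \sum_(1 <= k < n) k%:R ^- 2.

Lemma pint_invX k d : (0 < k < p)%N -> k%:R ^- d \in pint p.
Proof. by case/andP=> k0 kp; rewrite -exprVn rpredX // pint_invn // gtnNdvd. Qed.

Lemma pint_harm k : (k <= p)%N -> \sum_(0 <= i < k) i%:R^-1 \in pint p.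
Proof.
move=> kp; rewrite big_nat rpred_sum // => -[|i] /andP[_ ik];
  first by rewrite invr0 rpred0.
by rewrite pint_invn // gtnNdvd // (leq_trans ik).
Qed.

Lemma pint_dharm : dharm p \in pint p.
Proof.
rewrite /dharm big_nat rpred_sum // => k kp.
by case/andP: (kp) => _ /ltnW kp'; rewrite rpredM ?pint_harm ?pint_invX.
Qed.

Lemma pint_harm2 : harm2 p \in pint p.
Proof. by rewrite /harm2 big_nat rpred_sum // => k kp; rewrite pint_invX. Qed.

Lemma harm_pcong k : (k <= p)%N ->
  pcong p 1 (\sum_(0 <= i < k) i%:R^-1) (\sum_(0 <= i < k) i%:R ^+ q.+1).
Proof.
move=> kp; rewrite big_nat [X in pcong _ _ _ X]big_nat.
apply: pcong_sum => -[|i] /andP[_ ik].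
  by rewrite invr0 expr0n; apply: pcong_refl.
by rewrite -[i.+1%:R in X in pcong _ _ X]expr1; apply: pcong_inv => //; lia.
Qed.

(** With k^-2 replaced by k^q and 1/i by i^(q+1), Faulhaber leaves power sums of exponent q + (q + 2
    - i). Only [i = q] survives, so (q + 2) T is - 'C(q + 2, q) B_q, and -(q + 1)/2 = 1 - p/2 is 1
    modulo [p]. *)
Lemma dharm_pcong : pcong p 1 (dharm p) (bernoulli q).
Proof.
have pB : bernoulli q \in pint p by apply: bernoulli_pint; lia.
have [z pz zE] : pcong p 1 (q.+2%:R * dharm p) (- ('C(q.+2, q)%:R * bernoulli q)).
  apply: (@pcong_trans _ _ _
    (\sum_(1 <= k < p) k%:R ^+ q * (q.+2%:R * \sum_(0 <= i < k) i%:R ^+ q.+1))).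
    rewrite /dharm mulr_sumr big_nat [X in pcong _ _ _ X]big_nat.
    apply: pcong_sum => k kp; rewrite [X in pcong _ _ _ X]mulrCA.
    apply: pcongMl; rewrite ?rpred_nat //; case/andP: (kp) => k0 /ltnW kltp.
    apply: pcongM; rewrite ?rpredX ?rpred_nat //; [|by apply: pcong_inv;
      lia|exact: harm_pcong].
    by rewrite rpred_sum // => i _; rewrite rpredX ?rpred_nat.
  under eq_bigr => k _ do rewrite faulhaber mulr_sumr.
  rewrite exchange_big_nat /=.
  apply: (@pcong_trans _ _ _
    (\sum_(0 <= i < q.+2) 'C(q.+2, i)%:R * bernoulli i *
       (if (q.+2 - i == 2)%N then -1 else 0))).
    rewrite big_nat [X in pcong _ _ _ X]big_nat; apply: pcong_sum => i /andP[_ iq].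
    under eq_bigr => k _ do rewrite mulrCA -exprD.
    rewrite -mulr_sumr; apply: pcongMl.
      by apply: rpredM; [rewrite rpred_nat|apply: bernoulli_pint; lia].
    by apply: sum_pow_pcong => //; lia.
  rewrite !big_nat_recr //= big_nat big1 => [|i /andP[_ iq]]; last first.
    by rewrite (_ : (_ == _) = false) ?mulr0 //; lia.
  rewrite subSnn -addn2 addKn /= mulr0 addr0 add0r mulrN1; exact: pcong_refl.
have q0 : q.+2%:R != 0 :> rat by rewrite pnatr_eq0.
have pq2 : q.+2%:R^-1 \in pint p by rewrite pint_invn // gtnNdvd // pq.
exists (z * q.+2%:R^-1 - bernoulli q * 2^-1); first by apply: rpredB; apply: rpredM.
have bq : 'C(q.+2, q)%:R = q.+2%:R * q.+1%:R / 2 :> rat.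
  rewrite -bin_sub; last by lia.
  rewrite (_ : q.+2 - q = 2)%N; last by lia.
  have := bin_ffact q.+2 2;
    rewrite !ffactnS ffactn0 muln1 => /(congr1 (fun m => m%:R : rat)).
  by rewrite !natrM => <-; rewrite mulfK.
by apply: (mulfI q0); rewrite zE bq pq; field; rewrite -(natrD _ 2) pnatr_eq0.
Qed.

(** Squaring 1/i + 1/(p - i) = p/(i(p - i)) turns the sum of 2/(i(p - i)) into -2H modulo [p ^ 2];
    then both squares agree modulo [p ^ 4]. *)
Lemma central_bin_pcong :
  pcong p 4 'C((p + p).-1, p)%:R (1 - p%:R ^+ 2 * harm2 p).
Proof.
have -> : 'C((p + p).-1, p)%:R =
    \prod_(0 <= i < p ^ 1 | ~~ (p %| i)%N) (1 + (p ^ 1)%:R / i%:R) :> rat.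
  by have := @bin_mul_prodE p 1 1 p0 isT; rewrite muln1 binn mul1r expn1.
apply: pcong_sqr => //; first exact: coprime_prod_pcong1.
  exists (- (p%:R * harm2 p)); first by rewrite rpredN rpredM ?rpred_nat ?pint_harm2.
  by ring.
apply: pcong_trans (coprime_prod_sqr pp (ltn0Sn 0)) _; rewrite expn1.
have -> : \sum_(1 <= i < p | ~~ (p %| i)%N) 2 / (i%:R * (p - i)%:R) =
    p%:R ^+ 2 * (\sum_(1 <= i < p) (i%:R * (p - i)%:R) ^- 2) - 2 * harm2 p :> rat.
  have -> : 2 * harm2 p = \sum_(1 <= i < p) (i%:R ^- 2 + (p - i)%:R ^- 2).
    rewrite big_split /= -/(harm2 p) mulr_natl mulr2n; congr (_ + _).
    by rewrite /harm2 big_nat_rev; apply: eq_bigr => i _; rewrite add1n subSS.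
  rewrite mulr_sumr -sumrB.
  rewrite big_nat_cond [RHS]big_nat; apply: eq_big => [i|i /andP[/andP[i0 ip] _]].
    by case: (boolP (1 <= i < p)%N) => //= /andP[i0 ip]; rewrite gtnNdvd.
  have i1 : i%:R != 0 :> rat by rewrite pnatr_eq0 -lt0n.
  have i2 : p%:R - i%:R != 0 :> rat by rewrite subr_eq0 eqr_nat gtn_eqF.
  by rewrite natrB ?(ltnW ip) //; field; rewrite i1 i2.
set W := \sum_(_ <= _ < _) _.
have pW : W \in pint p.
  rewrite /W big_nat rpred_sum // => i /andP[i0 ip]; rewrite -exprVn rpredX // invfM.
  by apply: rpredM; rewrite pint_invn // gtnNdvd //; lia.
exists (W - harm2 p ^+ 2); first by rewrite rpredB ?rpredX ?pint_harm2.
by ring.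
Qed.

(** Each term with [k > 0] has a factor [p ^ 2 / k ^ 2], so its product is needed only modulo
    [p ^ 2], where it is linear in the harmonic sum. *)
Lemma sqbin_sum_pcong :
  pcong p 4 (sqbin_sum p) (1 + p%:R ^+ 2 * (harm2 p + 2 * p%:R * dharm p)).
Proof.
rewrite /sqbin_sum big_ltn // bin0 expr1n; apply: pcongD; first exact: pcong_refl.
have -> : harm2 p + 2 * p%:R * dharm p =
    \sum_(1 <= k < p) k%:R ^- 2 * (1 + p%:R ^+ 1 * \sum_(0 <= i < k) i%:R^-1) ^+ 2
    - p%:R ^+ 2 * \sum_(1 <= k < p) k%:R ^- 2 * (\sum_(0 <= i < k) i%:R^-1) ^+ 2.
  rewrite /harm2 /dharm !mulr_sumr -big_split -sumrB /=.
  by apply: eq_bigr => k _; ring.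
set V := \sum_(1 <= k < p) k%:R ^- 2 * (\sum_(0 <= i < k) i%:R^-1) ^+ 2.
have pV : V \in pint p.
  rewrite /V big_nat rpred_sum // => k kp; case/andP: (kp) => _ /ltnW kp'.
  by rewrite rpredM ?pint_invX ?rpredX ?pint_harm.
apply: (@pcong_trans _ _ _ (p%:R ^+ 2 * \sum_(1 <= k < p) k%:R ^- 2 *
    (1 + p%:R ^+ 1 * \sum_(0 <= i < k) i%:R^-1) ^+ 2)); last first.
  by exists V => //; ring.
rewrite mulr_sumr big_nat [X in pcong _ _ _ X]big_nat; apply: pcong_sum => k kp.
case/andP: (kp) => k0 kltp; have kp' := ltnW kltp.
rewrite bin_prodE // exprMn expr_div_n -[_ / _ * _]mulrA.
apply: (@pcong_scale p 2 2); apply: pcongMl; first exact: pint_invX.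
apply: pcongX; first by rewrite rpredD ?rpred1 ?rpredM ?rpredX ?rpred_nat ?pint_harm.
under eq_bigr => i _ do rewrite -[p%:R]expr1.
rewrite big_nat [X in pcong _ _ _ (_ + _ * X)]big_nat.
apply: (@pcong_prod1D p _ _ _ _ 1) => -[|i] /andP[_ ik]; first by rewrite invr0 rpred0.
by rewrite pint_invn // gtnNdvd // (ltn_trans ik).
Qed.

Lemma central_bin_sqbin_sum_pcong a : (0 < a)%N ->
  pcong p 4 ('C((p ^ a + p ^ a).-1, p ^ a)%:R * sqbin_sum (p ^ a))
            (1 + 2 * p%:R ^+ 3 * bernoulli q).
Proof.
have pS n : sqbin_sum n \in pint p by rewrite rpred_sum // => i _;
  rewrite rpredX ?rpred_nat.
have [pT pH] := (pint_dharm, pint_harm2).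
have pB : bernoulli q \in pint p by apply: bernoulli_pint; lia.
case: a => // a _; elim: a => [|a IHa]; last first.
  apply: pcong_trans IHa; apply: pcongM; rewrite ?rpred_nat //.
    exact: central_bin_reduce.
  exact: sqbin_sum_reduce.
rewrite expn1; apply: pcong_trans (pcongM _ _ central_bin_pcong sqbin_sum_pcong) _.
- by rewrite rpredB ?rpred1 ?rpredM ?rpredX ?rpred_nat.
- by rewrite rpredD ?rpred1 // rpredM ?rpredX ?rpred_nat // rpredD //
  rpredM ?rpred_nat // rpredM ?rpred_nat.
apply: (@pcong_trans _ _ _ (1 + 2 * p%:R ^+ 3 * dharm p)).
  (* In the product the [p ^ 2] terms cancel; this is the coefficient of [p ^ 4]. *)
  exists (- harm2 p * (harm2 p + 2 * p%:R * dharm p)).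
    by rewrite rpredM ?rpredN // rpredD // rpredM ?rpred_nat // rpredM ?rpred_nat.
  by ring.
apply: pcongD; first exact: pcong_refl.
rewrite -!(mulrA 2); apply: pcongMl; first exact: rpred_nat.
exact: (@pcong_scale p 3 1 _ _ dharm_pcong).
Qed.

End OddPrime.

Theorem theorem1p3 (p a : nat) (hp : prime p) (ha : (0 < a)%N) :
  rat_congr p 4
    ((p ^ a)%:R^-1 *
       \sum_(0 <= k < p ^ a) (21 * k + 8)%:R * 'C(2 * k, k)%:R ^+ 3)
    (8 + 16 * p%:R ^+ 3 * bernoulliz (p%:Z - 3)).
Proof.
have p0 := prime_gt0 hp.
set n := (p ^ a)%N; have n0 : (0 < n)%N by rewrite expn_gt0 p0.
have -> : n%:R^-1 * \sum_(0 <= k < n) (21 * k + 8)%:R * 'C(2 * k, k)%:R ^+ 3 =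
    2 ^+ 3 * ('C((n + n).-1, n)%:R * sqbin_sum n) :> rat.
  rewrite sum_cube_central_bin (_ : 'C(2 * n, n) = 2 * 'C((n + n).-1, n))%N.
    by rewrite natrM; field; rewrite pnatr_eq0 -lt0n.
  rewrite mul2n -addnn; case: (n) n0 => // m _; rewrite addSn /= binS mul2n -addnn.
  by congr (_ + _)%N; rewrite -[RHS]bin_sub ?addnK //; lia.
have [p2|p3] : p = 2 \/ (2 < p)%N by have := prime_gt1 hp; lia.
  (* Here the index is -1, and the factor [8 = 2 ^ 3] leaves only a congruence modulo 2 to prove. *)
  rewrite {1}p2 [bernoulliz _](_ : _ = 0) ?mulr0 ?addr0; last by rewrite p2.
  apply: pcong_rat_congr; rewrite ?rpred_nat //.
  rewrite [X in pcong _ _ _ X](_ : _ = 2 ^+ 3 * (1 * 1)); last by [].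
  apply: (@pcong_scale 2 3 1); rewrite /n p2.
  by apply: pcongM; rewrite ?rpred1 //;
    [exact: central_bin_pcong1|exact: sqbin_sum_pcong1].
have pq : p = (p - 3).+3 by lia.
have -> : bernoulliz (p%:Z - 3) = bernoulli (p - 3) by rewrite subzn.
have pB : bernoulli (p - 3) \in pint p by apply: bernoulli_pint => //; lia.
apply: pcong_rat_congr => //.
  by apply: rpredD; rewrite ?rpred_nat // rpredM // rpredM ?rpredX ?rpred_nat.
rewrite [X in pcong _ _ _ X](_ : _ =
  2 ^+ 3 * (1 + 2 * p%:R ^+ 3 * bernoulli (p - 3))); last by ring.
by apply: pcongMl; rewrite ?rpredX ?rpred_nat //; apply: central_bin_sqbin_sum_pcong.
Qed.
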